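(* For any Cantor minimal system $(X,\varphi)$ there is a unique (up to conjugacy) odometer $(Y,\psi)$ with the following properties: (1) $(Y,\psi)$ is a factor of $(X,\varphi)$; (2) every odometer which is a factor of $(X,\varphi)$ is also a factor of $(Y,\psi)$. Moreover, there is a factor map $\alpha:(X,\varphi)\to(Y,\psi)$ such that, if $\beta:(X,\varphi)\to(Z,\eta)$ is a factor map onto an odometer $(Z,\eta)$, then there is a (necessarily unique) factor map $\gamma:(Y,\psi)\to(Z,\eta)$ such that $\beta=\gamma\circ\alpha$.
   Context: A Cantor minimal system $(X,\varphi)$ is a minimal homeomorphism $\varphi$ of a space $X$ homeomorphic to the Cantor set. A factor map $(X,\varphi)\to(Y,\psi)$ is a continuous surjection $\alpha:X\to Y$ with $\alpha\circ\varphi=\psi\circ\alpha$; $(Y,\psi)$ is then a factor of $(X,\varphi)$. A conjugacy is a factor map that is a homeomorphism. For a sequence $(k_n)_{n\ge1}$ of positive integers, an odometer of type $(k_n)_{n\ge1}$ is the minimal system $(X,\varphi)$ with $X=\prod_{n=1}^\infty\{0,1,\ldots,k_n-1\}$ and $\varphi$ the addition of $(1,0,0,\ldots)$ with carrying (to the right). Trivial odometers, with $X$ finite (i.e. $k_n=1$ for all but finitely many $n$), are included. *)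

(* Defs.v *)
From HB Require Import structures.
From mathcomp Require Import all_boot.
From mathcomp Require Import boolp classical_sets topology cantor.

Set Implicit Arguments.
Unset Strict Implicit.
Unset Printing Implicit Defensive.

Local Open Scope classical_set_scope.

Definition homeomorphism (X Y : topologicalType) (f : X -> Y) : Prop :=
  continuous f /\
  exists g : Y -> X, [/\ continuous g, cancel f g & cancel g f].

Definition minimal_homeo (X : topologicalType) (phi : X -> X) : Prop :=
  homeomorphism phi /\
  forall A : set X, closed A -> phi @` A = A -> A = set0 \/ A = setT.

Definition cantor_minimal (X : topologicalType) (phi : X -> X) : Prop :=
  (exists h : X -> cantor_space, homeomorphism h) /\ minimal_homeo phi.

Definition factor_map (X Y : topologicalType) (phi : X -> X) (psi : Y -> Y)
    (alpha : X -> Y) : Prop :=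
  [/\ continuous alpha, alpha @` setT = setT
    & forall x, alpha (phi x) = psi (alpha x)].

Definition is_factor (X Y : topologicalType) (phi : X -> X) (psi : Y -> Y) :
    Prop :=
  exists alpha : X -> Y, factor_map phi psi alpha.

Definition conjugate (X Y : topologicalType) (phi : X -> X) (psi : Y -> Y) :
    Prop :=
  exists alpha : X -> Y, factor_map phi psi alpha /\ homeomorphism alpha.

(* The sequence (k_n)_{n >= 1} is indexed from 0 here. *)
Definition odometer_type (k : nat -> nat) : Prop := forall n, 0 < k n.

Definition odometer_space (k : nat -> nat) : Type :=
  prod_topology (fun n => discrete_topology 'I_(k n)).

HB.instance Definition _ (k : nat -> nat) := Topological.on (odometer_space k).

(* Digit n of x receives a carry when (1,0,0,...) is added: the 1 enters at
   digit 0, and digit n passes it on exactly when it is maximal. *)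
Fixpoint odometer_carry (k : nat -> nat) (x : odometer_space k) (n : nat) :
    bool :=
  if n is m.+1 then odometer_carry x m && ((x m : 'I_(k m)).+1 == k m)
  else true.

(* ordS is addition of 1 modulo k n on 'I_(k n). *)
Definition odometer (k : nat -> nat) (x : odometer_space k) :
    odometer_space k :=
  fun n => if odometer_carry x n then ordS (x n : 'I_(k n)) else x n.
Arguments odometer k x : clear implicits.

Definition maximal_odometer_factor (X : topologicalType) (phi : X -> X)
    (k : nat -> nat) : Prop :=
  is_factor phi (odometer k) /\
  forall l : nat -> nat, odometer_type l ->
    is_factor phi (odometer l) -> is_factor (odometer k) (odometer l).

(* Main.v *)
Require Import Defs.
From mathcomp Require Import all_boot.
From mathcomp Require Import boolp classical_sets topology cantor.

(** The factors of a minimal system (X, phi) that are finite cycles are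
described by clocks: a clock modulo p is a locally constant c : X -> nat with
c (phi x) = c x + 1 modulo p. By minimality two clocks modulo p differ by a
constant modulo p ([clock_unique], [clock_shift]), and the positive p that
admit a clock are closed under divisors and least common multiples
([clock_dvd], [clock_lcm]).

The first n digits of a point y of an odometer of type k form an integer
[residue y n] in mixed radix, smaller than [period k n] = k_0 ... k_(n-1), and
the odometer adds 1 to it modulo [period k n]. Hence a factor map onto the
odometer of type l pulls the residues back to clocks modulo all [period l n]
([factor_clock]). Conversely, clocks modulo all [period k n], normalized to
vanish at a base point, are coherent and assemble into a factor map onto the
odometer of type k, which is surjective by compactness ([clocks_factor]).

The maximal odometer is the one whose periods are the successive least common
multiples of all the p <= n that admit a clock. If alpha is a factor map onto
it and beta a factor map onto an odometer of type l, then every [period l n]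
divides some [period k m], so the clocks given by beta are, up to a
constant, reductions of those given by alpha; thus beta is constant on the
fibers of alpha ([factor_fiber]) and factors through it, continuously because
X is compact and odometers are Hausdorff ([factor_through]).

For uniqueness, if two odometer factors are factors of each other by gamma and
delta, then delta \o gamma is injective, since the clocks given by alpha and by
delta \o gamma \o alpha differ by constants; so gamma is a continuous bijection
of compact Hausdorff spaces ([mutual_factors_conjugate]). *)

Set Implicit Arguments.
Unset Strict Implicit.
Unset Printing Implicit Defensive.

Local Open Scope classical_set_scope.

(** * Locally constant functions and quotient maps *)

(** Continuity into the discrete space T, stated without putting a topology
on T; with T := Prop it says that a predicate defines a clopen set. *)
Definition locally_constant (X : topologicalType) (T : Type) (f : X -> T) :=
  forall x, \forall y \near x, f y = f x.

Lemma locally_constant_comp (X Y : topologicalType) (T : Type)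
    (f : X -> Y) (g : Y -> T) :
  continuous f -> locally_constant g -> locally_constant (g \o f).
Proof. by move=> cf lg x; exact: cf (lg (f x)). Qed.

Lemma locally_constant2 (X : topologicalType) (T U V : Type)
    (f : X -> T) (g : X -> U) (F : T -> U -> V) :
  locally_constant f -> locally_constant g ->
  locally_constant (fun x => F (f x) (g x)).
Proof.
move=> lf lg x; apply: filterS2 (lf x) (lg x) => y fyx gyx.
by rewrite fyx gyx.
Qed.

Lemma locally_constant1 (X : topologicalType) (T V : Type)
    (f : X -> T) (F : T -> V) :
  locally_constant f -> locally_constant (F \o f).
Proof. by move=> lf; exact: (locally_constant2 (fun a _ => F a) lf lf). Qed.

Lemma locally_constant_cst (X : topologicalType) (T : Type) (a : T) :
  locally_constant (fun _ : X => a).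
Proof. by move=> x; exact: nearW. Qed.

Lemma locally_constant_closed (X : topologicalType) (P : X -> Prop) :
  locally_constant P -> closed [set x | P x].
Proof.
move=> lP x clx; have [y [/= Py yx]] := clx _ (lP x).
by rewrite -yx.
Qed.

(** A continuous surjection from a compact space onto a Hausdorff space is a
quotient map. *)
Lemma quotient_continuous (X Y Z : topologicalType) (f : X -> Y) (g : Y -> Z) :
  compact [set: X] -> hausdorff_space Y -> continuous f -> f @` setT = setT ->
  continuous (g \o f) -> continuous g.
Proof.
move=> cX hY cf sf cgf; apply/continuous_closedP => C clC.
have -> : g @^-1` C = f @` ((g \o f) @^-1` C).
  rewrite eqEsubset; split=> [y Cgy|_ [x Cx <-]//].
  have : [set: Y] y by [].
  by rewrite -sf => -[x _ fxy]; exists x; rewrite //= fxy.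
apply: (compact_closed hY); apply: continuous_compact.
  exact: continuous_subspaceT.
apply: subclosed_compact cX _ => //.
by move/continuous_closedP: cgf; apply.
Qed.

Lemma surjectiveP (X Y : Type) (f : X -> Y) :
  f @` setT = setT -> forall y, exists x, f x = y.
Proof.
move=> sf y; have : [set: Y] y by [].
by rewrite -sf => -[x _ fxy]; exists x.
Qed.

Lemma surjectiveT (X Y : Type) (f : X -> Y) :
  (forall y, exists x, f x = y) -> f @` setT = setT.
Proof.
move=> sf; rewrite eqEsubset; split=> // y _.
by have [x <-] := sf y; exists x.
Qed.

(** * Odometers *)

Lemma odometer_continuous_into (X : topologicalType) (k : nat -> nat)
    (f : X -> odometer_space k) :
  (forall n, locally_constant (fun x => f x n)) -> continuous f.
Proof.
move=> lf x; apply/cvg_sup => i A [_ [[B oB <-] Bfx] sA].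
rewrite nbhs_filterE /=.
apply: filterS (lf i x) => y /= fyx.
by apply: sA; rewrite /= fyx.
Qed.

Lemma odometer_coordinate (k : nat -> nat) n :
  locally_constant (fun y : odometer_space k => y n).
Proof.
move=> y.
exact: (@proj_continuous _ (fun n => discrete_topology 'I_(k n)) n y _
  (discrete_set1 _)).
Qed.

Lemma odometer_hausdorff (k : nat -> nat) : hausdorff_space (odometer_space k).
Proof.
apply: (@hausdorff_product _ (fun n => discrete_topology 'I_(k n))) => n.
exact: discrete_hausdorff.
Qed.

(** The number of possible values of the first n digits of an odometer of
type k. *)
Definition period (k : nat -> nat) n := \prod_(i < n) k i.

(** The integer whose mixed-radix expansion, least significant digit first,
is given by the first n digits of y. *)
Definition residue (k : nat -> nat) (y : odometer_space k) n :=
  \sum_(i < n) (y i : 'I_(k i)) * period k i.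

Lemma periodS k n : period k n.+1 = period k n * k n.
Proof. by rewrite /period big_ord_recr. Qed.

Lemma period_dvd k m n : m <= n -> period k m %| period k n.
Proof.
move=> mn; rewrite -(subnKC mn); elim: (n - m) => [|d IHd].
  by rewrite addn0.
by rewrite addnS periodS dvdn_mulr.
Qed.

Lemma period_gt0 k n : odometer_type k -> 0 < period k n.
Proof. by move=> hk; rewrite /period prodn_gt0. Qed.

Lemma residueS k (y : odometer_space k) n :
  residue y n.+1 = residue y n + (y n : 'I_(k n)) * period k n.
Proof. by rewrite /residue big_ord_recr. Qed.

Lemma residue_lt k (y : odometer_space k) n : residue y n < period k n.
Proof.
elim: n => [|n IHn]; first by rewrite /residue /period !big_ord0.
rewrite residueS periodS mulnC.
apply: (@leq_trans (((y n : 'I_(k n))).+1 * period k n)); last first.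
  by rewrite mulnC leq_mul2l ltn_ord orbT.
by rewrite mulSn mulnC ltn_add2r.
Qed.

Lemma residue_mod k (y : odometer_space k) m n : m <= n ->
  residue y n = residue y m %[mod period k m].
Proof.
elim: n => [|n IHn]; first by rewrite leqn0 => /eqP ->.
rewrite leq_eqVlt => /orP[/eqP-> //|]; rewrite ltnS => mn.
rewrite residueS -modnDmr.
by have /dvdn_mull/eqP -> := period_dvd k mn; rewrite addn0 IHn.
Qed.

Lemma residue_inj k (y z : odometer_space k) :
  (forall n, residue y n = residue z n) -> y = z.
Proof.
move=> yz; apply: functional_extensionality_dep => n.
have := yz n.+1; rewrite !residueS yz => /addnI/eqP.
have P0 : 0 < period k n by apply: leq_ltn_trans (residue_lt y n).
rewrite eqn_pmul2r// => /eqP; exact: val_inj.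
Qed.

Lemma residue_odometer k (y : odometer_space k) n :
  residue (odometer k y) n = (residue y n).+1 %[mod period k n].
Proof.
(* The exact form: the carry out of the first n digits is worth one period. *)
suff <- : residue (odometer k y) n + odometer_carry y n * period k n =
    (residue y n).+1 by rewrite addnC modnMDl.
elim: n => [|n IHn]; first by rewrite /residue /period !big_ord0.
rewrite !residueS periodS -addSn -IHn /= {2}/odometer.
case: odometer_carry => /=; last by rewrite !mul0n !addn0.
rewrite mul1n -!addnA; congr addn.
case: (y n : 'I_(k n)) => d dk /=.
case: eqP => [dk1|/eqP dk1]; last first.
  by rewrite mul0n addn0 modn_small ?mulSn// ltn_neqAle dk1.
by rewrite mul1n dk1 modnn mul0n add0n -mulSn dk1 mulnC.
Qed.

Lemma residue_locally_constant k n :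
  locally_constant (fun y : odometer_space k => residue y n).
Proof.
elim: n => [|n IHn].
  have -> : (fun y : odometer_space k => residue y 0) = (fun=> 0).
    by apply/funext => y; rewrite /residue big_ord0.
  exact: locally_constant_cst.
have -> : (fun y : odometer_space k => residue y n.+1) =
    (fun y => residue y n + (y n : 'I_(k n)) * period k n).
  by apply/funext => y; rewrite residueS.
exact: (locally_constant2 (fun r (d : 'I_(k n)) => r + d * period k n)
  IHn (@odometer_coordinate k n)).
Qed.

(** * Clocks on a minimal system *)

(** A continuous equivariant map to the cycle Z/p, encoded by locally constant
representatives in nat, which need not be smaller than p. *)
Definition clock (X : topologicalType) (phi : X -> X) p (c : X -> nat) :=
  locally_constant c /\ forall x, c (phi x) = (c x).+1 %[mod p].

(** A nonempty invariant clopen set of a minimal system is the whole space. *)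
Lemma minimal_ind (X : topologicalType) (phi : X -> X) (P : X -> Prop) x0 :
  minimal_homeo phi -> locally_constant P ->
  (forall x, P (phi x) <-> P x) -> P x0 -> forall x, P x.
Proof.
move=> [[_ [g [_ _ gK]]] min] lP Pphi Px0 x.
have PE : phi @` [set x | P x] = [set x | P x].
  rewrite eqEsubset; split=> [_ [y Py <-]|y /= Py]; first exact/Pphi.
  by exists (g y); [apply/Pphi; rewrite gK|rewrite gK].
case: (min _ (locally_constant_closed lP) PE) => PT.
  by have : [set x | P x] x0 by []; rewrite PT.
by have : [set: X] x by []; rewrite -PT.
Qed.

Lemma clock_dvd (X : topologicalType) (phi : X -> X) p q c :
  q %| p -> clock phi p c -> clock phi q c.
Proof.
move=> qp [lc cphi]; split=> // x.
by rewrite -(modn_dvdm _ qp) cphi modn_dvdm.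
Qed.

Lemma clock_addr (X : topologicalType) (phi : X -> X) p c s :
  clock phi p c -> clock phi p (fun x => c x + s).
Proof.
move=> [lc cphi]; split=> [|x]; first exact: (locally_constant1 (addn^~ s) lc).
by rewrite -modnDml cphi modnDml addSn.
Qed.

Lemma eqmodS m n p : m.+1 = n.+1 %[mod p] <-> m = n %[mod p].
Proof.
rewrite -[m.+1]addn1 -[n.+1]addn1.
split=> /eqP; rewrite ?eqn_modDr => /eqP // mn.
by apply/eqP; rewrite eqn_modDr mn.
Qed.

Lemma clock_unique (X : topologicalType) (phi : X -> X) p c d x0 :
  minimal_homeo phi -> clock phi p c -> clock phi p d ->
  c x0 = d x0 %[mod p] -> forall x, c x = d x %[mod p].
Proof.
move=> min [lc cphi] [ld dphi]; apply: (minimal_ind min) => [|x].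
  exact: (locally_constant2 (fun a b => a = b %[mod p]) lc ld).
by rewrite cphi dphi; exact: eqmodS.
Qed.

Lemma clock_shift (X : topologicalType) (phi : X -> X) p c d x0 :
  minimal_homeo phi -> clock phi p c -> clock phi p d ->
  forall x, c x + d x0 = d x + c x0 %[mod p].
Proof.
move=> min cc cd.
apply: (clock_unique (x0 := x0) min (clock_addr _ cc) (clock_addr _ cd)).
by rewrite addnC.
Qed.

Lemma clock_normalize (X : topologicalType) (phi : X -> X) p c x0 :
  0 < p -> clock phi p c ->
  exists c', clock phi p c' /\ c' x0 = 0 %[mod p].
Proof.
move=> p0 cc; exists (fun x => c x + (p - c x0 %% p)); split.
  exact: clock_addr.
by rewrite -modnDml subnKC ?modnn ?mod0n// ltnW// ltn_mod.
Qed.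

Lemma eqmod_lcm m n p q :
  m = n %[mod p] -> m = n %[mod q] -> m = n %[mod lcmn p q].
Proof.
wlog mn : m n / m <= n => [th|].
  case/orP: (leq_total m n) => [/th //|/th nm mp mq].
  by apply/esym/nm; exact/esym.
move=> /esym/eqP + /esym/eqP; rewrite !eqn_mod_dvd// => mp mq.
by apply/esym/eqP; rewrite eqn_mod_dvd// dvdn_lcm mp.
Qed.

Lemma clock_lcm (X : topologicalType) (phi : X -> X) (x0 : X) p q c d :
  minimal_homeo phi -> 0 < p -> 0 < q -> clock phi p c -> clock phi q d ->
  exists e, clock phi (lcmn p q) e.
Proof.
move=> min p0 q0 /(clock_normalize x0 p0)[{}c [cc c0]].
move=> /(clock_normalize x0 q0)[{}d [cd d0]].
(* The points at which the two normalized clocks are compatible, so that some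
   residue modulo the least common multiple solves both congruences, form an
   invariant clopen set containing x0. *)
pose R a b n := n = a %[mod p] /\ n = b %[mod q].
have [[lc cphi] [ld dphi]] := (cc, cd).
have Rex : forall x, exists n, R (c x) (d x) n.
  apply: (minimal_ind (x0 := x0) min) => [|x|]; last by exists 0.
    exact: (locally_constant2 (fun a b => exists n, R a b n) lc ld).
  split=> -[n [np nq]]; last first.
    by exists n.+1; split; rewrite ?cphi ?dphi; apply/eqmodS.
  (* This is n - 1 modulo p and modulo q. *)
  exists (n + (p * q).-1); split; apply/eqmodS;
    rewrite -addnS prednK ?muln_gt0 ?p0//.
    by rewrite addnC mulnC modnMDl np cphi.
  by rewrite addnC modnMDl nq dphi.
pose e x := xget 0 [set n | R (c x) (d x) n].
have eR x : R (c x) (d x) (e x) by apply: (xgetPex 0 (Rex x)).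
exists e; split=> [|x].
  exact: (locally_constant2 (fun a b => xget 0 [set n | R a b n]) lc ld).
have [ep eq] := eR x; have [ephi_p ephi_q] := eR (phi x).
apply: eqmod_lcm; rewrite ?ephi_p ?ephi_q ?cphi ?dphi; exact/eqmodS/esym.
Qed.

(** * The maximal odometer type *)

(** The least common multiple of the m with 0 < m <= n that admit a clock. *)
Fixpoint lcm_periods (X : topologicalType) (phi : X -> X) n :=
  if n is m.+1 then
    if `[< exists c, clock phi m.+1 c >] then lcmn (lcm_periods phi m) m.+1
    else lcm_periods phi m
  else 1.

Lemma lcm_periods_gt0 (X : topologicalType) (phi : X -> X) n :
  0 < lcm_periods phi n.
Proof. by elim: n => //= n IHn; case: ifP => // _; rewrite lcmn_gt0 IHn. Qed.

Lemma dvdn_lcm_periodsS (X : topologicalType) (phi : X -> X) n :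
  lcm_periods phi n %| lcm_periods phi n.+1.
Proof. by rewrite /=; case: ifP => // _; exact: dvdn_lcml. Qed.

Lemma lcm_periods_clock (X : topologicalType) (phi : X -> X) (x0 : X) n :
  minimal_homeo phi -> exists c, clock phi (lcm_periods phi n) c.
Proof.
move=> min; elim: n => [|n [c cc]] /=.
  exists (fun=> 0); split=> [|x]; first exact: locally_constant_cst.
  by rewrite !modn1.
case: asboolP => [[d cd]|_]; last by exists c.
exact: (clock_lcm x0 min (lcm_periods_gt0 phi n) _ cc cd).
Qed.

Lemma dvdn_lcm_periods (X : topologicalType) (phi : X -> X) p c :
  0 < p -> clock phi p c -> p %| lcm_periods phi p.
Proof.
case: p => // p _ cc /=; rewrite asboolT; last by exists c.
exact: dvdn_lcmr.
Qed.

(** The type whose periods are the successive values of [lcm_periods]. *)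
Definition max_type (X : topologicalType) (phi : X -> X) n :=
  lcm_periods phi n.+1 %/ lcm_periods phi n.

Lemma period_max_type (X : topologicalType) (phi : X -> X) n :
  period (max_type phi) n = lcm_periods phi n.
Proof.
elim: n => [|n IHn]; first by rewrite /period big_ord0.
by rewrite periodS IHn mulnC divnK// dvdn_lcm_periodsS.
Qed.

Lemma max_typeP (X : topologicalType) (phi : X -> X) :
  odometer_type (max_type phi).
Proof.
move=> n; rewrite divn_gt0 ?lcm_periods_gt0//.
by rewrite dvdn_leq ?lcm_periods_gt0 ?dvdn_lcm_periodsS.
Qed.

(** * Clocks and factor maps onto odometers *)

Lemma factor_clock (X : topologicalType) (phi : X -> X) l
    (beta : X -> odometer_space l) n :
  factor_map phi (odometer l) beta ->
  clock phi (period l n) (fun x => residue (beta x) n).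
Proof.
move=> [cb _ bphi]; split=> [|x]; last by rewrite bphi residue_odometer.
exact: (locally_constant_comp cb (@residue_locally_constant l n)).
Qed.

Lemma clocks_factor (X : topologicalType) (phi : X -> X) (x0 : X) k :
  compact [set: X] -> minimal_homeo phi -> odometer_type k ->
  (forall n, exists c, clock phi (period k n) c) ->
  exists alpha : X -> odometer_space k, factor_map phi (odometer k) alpha.
Proof.
move=> cX min hk clocks.
have P0 n : 0 < period k n by exact: period_gt0.
have nclocks n : {c | clock phi (period k n) c /\ c x0 = 0 %[mod period k n]}.
  by apply: cid; have [c cc] := clocks n; exact: clock_normalize cc.
pose a n := sval (nclocks n).
have clk n : clock phi (period k n) (a n) by exact: (svalP (nclocks n)).1.
have a0 n : a n x0 = 0 %[mod period k n] by exact: (svalP (nclocks n)).2.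
have coh n x : a n.+1 x = a n x %[mod period k n].
  have PS := period_dvd k (leqnSn n).
  apply: (clock_unique (x0 := x0) min (clock_dvd PS (clk n.+1)) (clk n)).
  by rewrite -(modn_dvdm _ PS) a0 modn_dvdm// a0.
have dlt n x : (a n.+1 x %% period k n.+1) %/ period k n < k n.
  by rewrite ltn_divLR// mulnC -periodS ltn_mod.
(* Digit n is the leading digit of the residue given by the clock a n.+1, whose
   lower digits agree with those given by a n. *)
pose alpha x : odometer_space k := fun n => Ordinal (dlt n x).
have res x n : residue (alpha x) n = a n x %% period k n.
  elim: n => [|n IHn].
    by rewrite /residue /period !big_ord0 modn1.
  rewrite residueS IHn -coh /=.
  rewrite -(modn_dvdm (a n.+1 x) (period_dvd k (leqnSn n))).
  by rewrite addnC -divn_eq.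
exists alpha; split.
- apply: odometer_continuous_into => n x.
  apply: filterS ((clk n.+1).1 x) => y ayx.
  by apply: val_inj; rewrite /= ayx.
- apply: surjectiveT => y.
  (* A preimage of y is a cluster point of the points of the orbit of x0 reached
     at the times given by the initial segments of y. *)
  pose F := (fun n => iter (residue y n) phi x0) @ \oo.
  have [x [_ clx]] := cX F _ (filterT : F setT).
  exists x; apply: residue_inj => n; rewrite res.
  have Fn : F [set z | a n z = residue y n %[mod period k n]].
    exists n => // m /= nm.
    rewrite -(residue_mod y nm).
    elim: (residue y m) => [|j IHj]; first exact: a0.
    by rewrite /= (clk n).2; apply/eqmodS.
  have [z [/= az zx]] := clx _ _ Fn ((clk n).1 x).
  by rewrite -zx az modn_small// residue_lt.
- move=> x; apply: residue_inj => n.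
  rewrite res (clk n).2 -[RHS](modn_small (residue_lt _ _)).
  rewrite residue_odometer res.
  by apply/esym/eqmodS; rewrite modn_mod.
Qed.

(** A factor map onto an odometer is constant on the fibers of any factor map
onto an odometer whose periods are multiples of those of the first. *)
Lemma factor_fiber (X : topologicalType) (phi : X -> X) k l
    (alpha : X -> odometer_space k) (beta : X -> odometer_space l) x x' :
  minimal_homeo phi ->
  factor_map phi (odometer k) alpha -> factor_map phi (odometer l) beta ->
  (forall n, exists m, period l n %| period k m) ->
  alpha x = alpha x' -> beta x = beta x'.
Proof.
move=> min fa fb lk axx; apply: residue_inj => n.
have [m lkm] := lk n.
have /(_ x) := clock_shift x' min (factor_clock n fb)
  (clock_dvd lkm (factor_clock m fa)).
rewrite axx addnC => /eqP; rewrite eqn_modDl.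
by rewrite !modn_small ?residue_lt// => /eqP.
Qed.

Lemma factor_through (X : topologicalType) (phi : X -> X) k l
    (alpha : X -> odometer_space k) (beta : X -> odometer_space l) :
  compact [set: X] -> minimal_homeo phi ->
  factor_map phi (odometer k) alpha -> factor_map phi (odometer l) beta ->
  (forall n, exists m, period l n %| period k m) ->
  exists! gamma : odometer_space k -> odometer_space l,
    factor_map (odometer k) (odometer l) gamma /\ beta =1 gamma \o alpha.
Proof.
move=> cX min fa fb lk.
have [ca /surjectiveP sa aphi] := fa; have [cb /surjectiveP sb bphi] := fb.
pose gamma y := beta (sval (cid (sa y))).
have gaE x : gamma (alpha x) = beta x.
  by apply: (factor_fiber min fa fb lk); exact: svalP (cid (sa (alpha x))).
exists gamma; split=> [|gamma' [_ bg']]; last first.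
  by apply/funext => y; have [x <-] := sa y; rewrite gaE bg'.
split=> [|x]; last by rewrite /= gaE.
split.
- apply: (quotient_continuous cX (@odometer_hausdorff k) ca (surjectiveT sa)).
  by have -> : gamma \o alpha = beta by apply/funext => x /=.
- by apply: surjectiveT => z; have [x <-] := sb z; exists (alpha x).
- by move=> y; have [x <-] := sa y; rewrite -aphi !gaE bphi.
Qed.

(** An odometer that is a factor of a minimal system is coalescent: each factor
map onto itself is injective. *)
Lemma odometer_endo_inj (X : topologicalType) (phi : X -> X) k
    (alpha : X -> odometer_space k)
    (eps : odometer_space k -> odometer_space k) :
  minimal_homeo phi -> factor_map phi (odometer k) alpha ->
  factor_map (odometer k) (odometer k) eps -> injective eps.
Proof.
move=> min fa fe y y'.
have [ca /surjectiveP sa aphi] := fa; have [ce /surjectiveP se ephi] := fe.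
have fea : factor_map phi (odometer k) (eps \o alpha).
  split=> [x||x]; last by rewrite /= aphi ephi.
    by apply: continuous_comp; [exact: ca|exact: ce].
  apply: surjectiveT => z; have [w <-] := se z; have [x <-] := sa w.
  by exists x.
have [x <-] := sa y; have [x' <-] := sa y' => exx.
by apply: (factor_fiber min fea fa) => // n; exists n.
Qed.

Lemma mutual_factors_conjugate (X : topologicalType) (phi : X -> X) k k' :
  compact [set: X] -> minimal_homeo phi -> is_factor phi (odometer k) ->
  is_factor (odometer k) (odometer k') -> is_factor (odometer k') (odometer k) ->
  conjugate (odometer k) (odometer k').
Proof.
move=> cX min [alpha fa] [gamma fg] [delta fd].
have [ca sa _] := fa; have [cg sg gphi] := fg; have [cd sd dphi] := fd.
have cK : compact [set: odometer_space k].
  by rewrite -sa; apply: continuous_compact cX; exact: continuous_subspaceT.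
have gI : injective gamma.
  have fdg : factor_map (odometer k) (odometer k) (delta \o gamma).
    split=> [y||y]; last by rewrite /= gphi dphi.
      by apply: continuous_comp; [exact: cg|exact: cd].
    apply: surjectiveT => z.
    have [w <-] := surjectiveP sd z; have [y <-] := surjectiveP sg w.
    by exists y.
  by move=> y y' gyy; apply: (odometer_endo_inj min fa fdg); rewrite /= gyy.
exists gamma; split=> //; split=> //.
pose g z := sval (cid (surjectiveP sg z)).
have gK : cancel g gamma by move=> z; exact: svalP (cid (surjectiveP sg z)).
have Kg : cancel gamma g by move=> y; apply: gI.
exists g; split=> //.
apply: (quotient_continuous cK (@odometer_hausdorff k') cg sg).
have -> : g \o gamma = id by apply/funext => y; exact: Kg.
by move=> y; exact: cvg_id.
Qed.

Lemma cantor_compact (X : topologicalType) (h : X -> cantor_space) :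
  homeomorphism h -> compact [set: X].
Proof.
move=> [_ [g [cg hK gK]]].
have <- : g @` setT = setT by apply: surjectiveT => x; exists (h x).
apply: continuous_compact cantor_space_compact.
exact: continuous_subspaceT.
Qed.

Theorem theorem4p12 (X : topologicalType) (phi : X -> X)
    (hphi : cantor_minimal phi) :
  exists k : nat -> nat,
    [/\ odometer_type k,
        maximal_odometer_factor phi k,
        (forall k' : nat -> nat, odometer_type k' ->
           maximal_odometer_factor phi k' ->
           conjugate (odometer k) (odometer k'))
      & exists alpha : X -> odometer_space k,
          factor_map phi (odometer k) alpha /\
          forall (l : nat -> nat) (beta : X -> odometer_space l),
            odometer_type l -> factor_map phi (odometer l) beta ->
            exists! gamma : odometer_space k -> odometer_space l,
              factor_map (odometer k) (odometer l) gamma /\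
              beta =1 gamma \o alpha].
Proof.
have [[h hh] min] := hphi.
have cX := cantor_compact hh.
have [_ [hinv _]] := hh; pose x0 := hinv point.
pose k := max_type phi.
have hk : odometer_type k by exact: max_typeP.
have [alpha fa] : exists alpha : X -> odometer_space k,
    factor_map phi (odometer k) alpha.
  apply: (clocks_factor x0 cX min hk) => n.
  by rewrite period_max_type; exact: lcm_periods_clock x0 n min.
have univ l (beta : X -> odometer_space l) :
    odometer_type l -> factor_map phi (odometer l) beta ->
    exists! gamma : odometer_space k -> odometer_space l,
      factor_map (odometer k) (odometer l) gamma /\ beta =1 gamma \o alpha.
  move=> hl fb; apply: (factor_through cX min fa fb) => n.
  (* The p-th value of lcm_periods is a multiple of p when p admits a clock. *)
  exists (period l n); rewrite period_max_type.
  exact: dvdn_lcm_periods (period_gt0 n hl) (factor_clock n fb).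
have maxk : maximal_odometer_factor phi k.
  split=> [|l hl [beta fb]]; first by exists alpha.
  by have [gamma [[fg _] _]] := univ l beta hl fb; exists gamma.
exists k; split=> //; last by exists alpha.
move=> k' hk' [fk' maxk']; apply: (mutual_factors_conjugate cX min) maxk.1 _ _.
  exact: maxk.2.
exact: maxk' hk maxk.1.
Qed.
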